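(* Let $n,d\ge 1$ be integers, let $P_1$ and $P_2$ be any two positions in $[n]^d$, and let $u_1^*,u_2^*,\dots,u_f^*$ and $v_1^*,v_2^*,\dots,v_f^*$ be any two build-ups from $P_1$ to $P_2$. Then there exists a permutation $\sigma$ of $\{1,2,\dots,f\}$ such that $u_{\sigma(i)}^*=v_i^*$ for $1\le i\le f$.
   Context: $[n]^d$ denotes the graph whose vertices (also called cubes) are the $d$-tuples $(x_1,\dots,x_d)$ with $x_i\in\{1,\dots,n\}$; two vertices are neighbours if they differ in exactly one coordinate, and in that coordinate by exactly $1$. A position is any subset of the vertices of $[n]^d$; its vertices are called black and the remaining vertices are called white. A build-up move adds to the current position a white vertex having exactly $d$ black neighbours in the current position. A build-up from $P_1$ to $P_2$ is a finite sequence of build-up moves transforming $P_1$ into $P_2$. A build-up is encoded as the sequence $v_1^*,\dots,v_f^*$, where $v_i$ is the vertex added in the $i$-th move and $v_i^*$ is the pair $(v_i,N(v_i))$, with $N(v_i)$ the set of the $d$ black neighbours that $v_i$ has in the position just before it is added. *)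

(* Defs.v *)
From mathcomp Require Import all_boot all_fingroup.

Set Implicit Arguments.
Unset Strict Implicit.
Unset Printing Implicit Defensive.

(* Coordinates range over 'I_n = {0, ..., n-1}, i.e. {1, ..., n} shifted by
   one. *)
Definition cube (n d : nat) := d.-tuple 'I_n.

Definition neighbours (n d : nat) : rel (cube n d) := fun x y =>
  [exists i : 'I_d,
     ((tnth x i == (tnth y i).+1 :> nat) || (tnth y i == (tnth x i).+1 :> nat))
     && [forall j : 'I_d, (j != i) ==> (tnth x j == tnth y j)]].

(* The set of black vertices. *)
Definition position (n d : nat) := {set cube n d}.

Definition black_neighbours (n d : nat) (P : position n d) (v : cube n d) :
    {set cube n d} :=
  [set w in P | neighbours v w].

Definition build_up_move (n d : nat) (P : position n d) (v : cube n d) : bool :=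
  (v \notin P) && (#|black_neighbours P v| == d).

Definition position_after (n d f : nat) (P : position n d)
    (v : f.-tuple (cube n d)) (k : nat) : position n d :=
  P :|: [set w in take k v].

Definition build_up (n d f : nat) (P1 P2 : position n d)
    (v : f.-tuple (cube n d)) : Prop :=
  (forall i : 'I_f, build_up_move (position_after P1 v i) (tnth v i))
  /\ position_after P1 v f = P2.

(* With indices counted from 0, [position_after P v i] is the position just
   before [tnth v i] is added. *)
Definition star (n d f : nat) (P : position n d) (v : f.-tuple (cube n d))
    (i : 'I_f) : cube n d * {set cube n d} :=
  (tnth v i, black_neighbours (position_after P v i) (tnth v i)).

(* Main.v *)
(* At each vertex the in-degree of the edges oriented by order of addition is
   prescribed, and such an acyclic orientation is unique: going through the
   vertices x in the order of u, every earlier neighbour w has the same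
   predecessors in u and v, so x does not precede w in v either. Hence the
   neighbours of x that are black in u are black in v, and both sets have d
   elements. *)

Require Import Defs.
From mathcomp Require Import all_boot all_fingroup.

Lemma neighbours_sym (n d : nat) : symmetric (@neighbours n d).
Proof.
move=> x y; apply: eq_existsb => i; rewrite orbC; congr (_ && _).
by apply: eq_forallb => j; rewrite [tnth y j == _]eq_sym.
Qed.

Lemma in_position_after {n d f : nat} (P : position n d)
    (u : f.-tuple (cube n d)) (k : nat) (x : cube n d) : k <= f ->
  (x \in position_after P u k) = (x \in P) || (index x u < k).
Proof. by move=> lekf; rewrite !inE in_take_leq ?size_tuple. Qed.

Lemma build_up_white {n d f : nat} {P1 P2 : position n d}
    {u : f.-tuple (cube n d)} (i : 'I_f) : build_up P1 P2 u ->
  (tnth u i \notin P1) && (i <= index (tnth u i) u).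
Proof.
case=> /(_ i)/andP[+ _] _.
by rewrite in_position_after ?(ltnW (ltn_ord i)) // negb_or -leqNgt.
Qed.

(** A cube is white when it is added, so its first occurrence in [u] cannot come before that move;
    two moves adding the same cube thus bound each other's index. *)
Lemma build_up_uniq {n d f : nat} {P1 P2 : position n d}
    {u : f.-tuple (cube n d)} : build_up P1 P2 u -> uniq u.
Proof.
move=> hu.
have le_index (i j : 'I_f) : tnth u i = tnth u j -> j <= i.
  move=> eij; have /andP[_ leji] := build_up_white j hu.
  apply: leq_trans leji _; rewrite -eij (tnth_nth (tnth u i)).
  by apply: index_nth; rewrite size_tuple.
apply/tuple_uniqP => i j eij; apply/val_inj/anti_leq.
by rewrite !le_index.
Qed.

Lemma index_tnth {T : eqType} {f : nat} {u : f.-tuple T} (i : 'I_f) :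
  uniq u -> index (tnth u i) u = i.
Proof. by move=> uu; rewrite (tnth_nth (tnth u i)) index_uniq ?size_tuple. Qed.

(** Hence any two build-ups from [P1] to [P2] add the same cubes. *)
Lemma mem_build_up {n d f : nat} {P1 P2 : position n d}
    {u : f.-tuple (cube n d)} (x : cube n d) :
  build_up P1 P2 u -> (x \in u) = (x \in P2 :\: P1).
Proof.
move=> hu; rewrite inE -hu.2 in_position_after //.
have -> : (index x u < f) = (x \in u) by rewrite -index_mem size_tuple.
case: (boolP (x \in u)) => [/tnthP[i ->]|_]; last by case: (x \in P1).
by have /andP[->] := build_up_white i hu; rewrite orbT.
Qed.

(** Indexed by the cube instead of the move number, so that two build-ups can be compared at the
    same cube. *)
Definition black_before {n d f : nat} (P : position n d)
    (u : f.-tuple (cube n d)) (x : cube n d) : {set cube n d} :=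
  black_neighbours (position_after P u (index x u)) x.

(** A cube absent from [u] has index [f], which is never below [index x u], so the comparison of
    indices is correct for it too. *)
Lemma in_black_before {n d f : nat} (P : position n d)
    (u : f.-tuple (cube n d)) (x w : cube n d) :
  (w \in black_before P u x) =
  ((w \in P) || (index w u < index x u)) && neighbours x w.
Proof.
rewrite inE in_position_after //.
by have := index_size x u; rewrite size_tuple.
Qed.

Lemma star_build_up {n d f : nat} {P1 P2 : position n d}
    {u : f.-tuple (cube n d)} (i : 'I_f) : build_up P1 P2 u ->
  star P1 u i = (tnth u i, black_before P1 u (tnth u i)).
Proof. by move=> hu; rewrite /black_before (index_tnth _ (build_up_uniq hu)). Qed.

Lemma card_black_before {n d f : nat} {P1 P2 : position n d}
    {u : f.-tuple (cube n d)} (x : cube n d) :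
  build_up P1 P2 u -> x \in u -> #|black_before P1 u x| = d.
Proof.
move=> hu /tnthP[i ->]; rewrite /black_before (index_tnth _ (build_up_uniq hu)).
by have /andP[_ /eqP] := hu.1 i.
Qed.

Lemma black_before_unique {n d f : nat} {P1 P2 : position n d}
    {u v : f.-tuple (cube n d)} (x : cube n d) :
  build_up P1 P2 u -> build_up P1 P2 v -> x \in u ->
  black_before P1 u x = black_before P1 v x.
Proof.
move=> hu hv; have [m] := ubnP (index x u); elim: m x => // m IH x lexm xu.
have memvu y : (y \in v) = (y \in u).
  by rewrite (mem_build_up _ hu) (mem_build_up _ hv).
apply/eqP; rewrite eqEcard (card_black_before _ hu) // (card_black_before _ hv)
  ?memvu // leqnn andbT.
apply/subsetP=> w; rewrite !in_black_before => /andP[+ nxw]; rewrite nxw andbT.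
case: (boolP (w \in P1)) => //= wP1 ltwx.
have wu : w \in u by rewrite -index_mem (ltn_trans ltwx) // index_mem.
(* Since [x] is not in [P1], it can lie in [black_before P1 _ w] only by preceding [w]. *)
have xP1 : x \notin P1.
  by move: xu; rewrite (mem_build_up _ hu) inE => /andP[].
(* The induction hypothesis at [w], tested on [x]: as [x] does not precede [w] in [u], it does not
   in [v]. *)
have /setP/(_ x) := IH w (leq_trans ltwx lexm) wu.
rewrite !in_black_before neighbours_sym nxw (negbTE xP1) /= !andbT.
rewrite ltnNge (ltnW ltwx) /= => /esym/negbT; rewrite -leqNgt leq_eqVlt.
(* Equal indices in [v] would force [w = x], but [w] strictly precedes [x] in [u]. *)
case/orP=> // /eqP eq_index; suff ewx : w = x by rewrite ewx ltnn in ltwx.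
by apply: index_inj eq_index; rewrite ?memvu.
Qed.

Theorem theorem2 (n d : nat) (hn : 1 <= n) (hd : 1 <= d)
  (P1 P2 : position n d) (f : nat) (u v : f.-tuple (cube n d))
  (hu : build_up P1 P2 u) (hv : build_up P1 P2 v) :
  exists sigma : 'S_f,
    forall i : 'I_f, star P1 u (sigma i) = star P1 v i.
Proof.
(* Both tuples list [P2 :\: P1] without repetition; the permutation relating them is the witness. *)
have /tuple_permP[s vE] : perm_eq v u.
  apply: uniq_perm; rewrite ?(build_up_uniq hu) ?(build_up_uniq hv) // => x.
  by rewrite (mem_build_up _ hu) (mem_build_up _ hv).
exists s => i; rewrite (star_build_up _ hu) (star_build_up _ hv).
have -> : tnth v i = tnth u (s i) by rewrite (val_inj vE) tnth_mktuple.
by rewrite (black_before_unique _ hu hv) // mem_tnth.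
Qed.
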